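(* Let $G$ be a group. Assume that $\operatorname{Aut}(G)$ acts by isometries on a geodesic Gromov-hyperbolic space $X$ in such a way that the action of the subgroup $\operatorname{Inn}(G)\le\operatorname{Aut}(G)$ of inner automorphisms on $X$ is non-elementary. Then $G$ has property $R_\infty$.
   Context: An isometric action of a group $\Gamma$ on a geodesic Gromov-hyperbolic space $X$ is called non-elementary if $\Gamma$ contains two independent loxodromic elements, that is, two loxodromic elements whose fixed-point sets in the Gromov boundary $\partial X$ are disjoint. For a group $G$ and $\varphi\in\operatorname{Aut}(G)$, elements $g,h\in G$ are $\varphi$-twisted conjugate if there is $x\in G$ with $h=x\,g\,\varphi(x)^{-1}$. This is an equivalence relation, and the (possibly infinite) number of its classes is the Reidemeister number $R(\varphi)$. The group $G$ has property $R_\infty$ if $R(\varphi)=\infty$ for every $\varphi\in\operatorname{Aut}(G)$. *)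

(* Defs.v *)
From HB Require Import structures.
From mathcomp Require Import all_boot all_order all_algebra.
From mathcomp Require Import all_classical all_reals.
From mathcomp Require Import topology normedtype.

Set Implicit Arguments.
Unset Strict Implicit.
Unset Printing Implicit Defensive.

Import Order.TTheory GRing.Theory Num.Theory.

Local Open Scope classical_set_scope.
Local Open Scope ring_scope.

Section AutomorphismGroup.
Local Open Scope group_scope.
Variable G : groupType.

Record Aut := MkAut {
  aut_fun :> G -> G ;
  autM : {morph aut_fun : x y / x * y} ;
  aut_bij : bijective aut_fun }.

Lemma aut_eqP (f g : Aut) : f =1 g -> f = g.
Proof.
case: f g => [f fM fb] [g gM gb] /= /funext fg; case: g / fg in gM gb *.
by rewrite (Prop_irrelevance fM gM) (Prop_irrelevance fb gb).
Qed.

HB.instance Definition _ := gen_eqMixin Aut.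
HB.instance Definition _ := gen_choiceMixin Aut.

Fact aut_one_morph : {morph (@idfun G) : x y / x * y}.
Proof. by []. Qed.

Definition aut_one : Aut := MkAut aut_one_morph (inv_bij (fun=> erefl)).

Fact aut_mul_morph (f g : Aut) : {morph f \o g : x y / x * y}.
Proof. by move=> x y /=; rewrite !autM. Qed.

Definition aut_mul (f g : Aut) : Aut :=
  MkAut (@aut_mul_morph f g) (bij_comp (aut_bij f) (aut_bij g)).

Fact aut_inv_exists (f : Aut) : exists g : Aut, cancel f g /\ cancel g f.
Proof.
have [g fK gK] := aut_bij f.
have gM : {morph g : x y / x * y}.
  by move=> x y; apply: (can_inj fK); rewrite autM !gK.
by exists (MkAut gM (Bijective gK fK)).
Qed.

Definition aut_inv (f : Aut) : Aut := sval (cid (aut_inv_exists f)).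

Fact aut_mulA : associative aut_mul.
Proof. by move=> f g h; exact: aut_eqP. Qed.
Fact aut_mul1 : left_id aut_one aut_mul.
Proof. by move=> f; exact: aut_eqP. Qed.
Fact aut_mulr1 : right_id aut_one aut_mul.
Proof. by move=> f; exact: aut_eqP. Qed.
Fact aut_mulV : left_inverse aut_one aut_inv aut_mul.
Proof.
by move=> f; apply: aut_eqP => x; rewrite /aut_inv; case: cid => g [] /= fK _.
Qed.
Fact aut_mulrV : right_inverse aut_one aut_inv aut_mul.
Proof.
by move=> f; apply: aut_eqP => x; rewrite /aut_inv; case: cid => g [] /= _ gK.
Qed.

HB.instance Definition _ := isGroup.Build Aut
  aut_mulA aut_mul1 aut_mulr1 aut_mulV aut_mulrV.

Fact inner_morph (g : G) : {morph (fun x => g * x * g^-1) : x y / x * y}.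
Proof. by move=> x y; rewrite !mulgA mulgVK. Qed.

Fact inner_bij (g : G) : bijective (fun x => g * x * g^-1).
Proof.
by exists (fun x => g^-1 * x * g) => x;
  rewrite !mulgA ?mulVg ?mulgV mul1g ?mulgVK ?mulgK.
Qed.

Definition inner (g : G) : Aut := MkAut (inner_morph g) (inner_bij g).

Definition Inn : set Aut := range inner.

End AutomorphismGroup.

Section TwistedConjugacy.
Local Open Scope group_scope.
Variables (G : groupType) (phi : Aut G).

Definition twisted_conjugate (g h : G) : Prop :=
  exists x : G, h = x * g * (phi x)^-1.

Definition reidemeister_classes : set (set G) :=
  range (fun g => [set h | twisted_conjugate g h]).

End TwistedConjugacy.

(* R(phi) is the cardinality of [reidemeister_classes phi]. *)
Definition R_infinity (G : groupType) : Prop :=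
  forall phi : Aut G, infinite_set (reidemeister_classes phi).

Section HyperbolicSpaces.
Variables (R : realType) (X : metricType R).

Definition geodesic_space : Prop :=
  forall x y : X, exists c : R -> X,
    [/\ c 0 = x, c (mdist x y) = y &
        forall s t, s \in `[0, mdist x y] -> t \in `[0, mdist x y] ->
          mdist (c s) (c t) = `|s - t|].

Definition gromov_product (w x y : X) : R :=
  (mdist w x + mdist w y - mdist x y) / 2.

Definition gromov_hyperbolic : Prop :=
  exists delta : R, 0 <= delta /\
    forall w x y z : X,
      Num.min (gromov_product w x y) (gromov_product w y z) - delta
        <= gromov_product w x z.

(* (u_i | v_j)_w tends to +oo as i and j do.  The condition does not depend on
   the base point w; quantifying over w avoids choosing one. *)
Definition gromov_equivalent (u v : nat -> X) : Prop :=
  forall w : X,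
    gromov_product w (u p.1) (v p.2) @[p --> (\oo, \oo)] --> +oo.

Definition converges_to_infinity (u : nat -> X) : Prop := gromov_equivalent u u.

(* The sequential boundary, which needs no properness assumption on X: its
   points are the equivalence classes of sequences converging to infinity. *)
Definition gromov_boundary : set (set (nat -> X)) :=
  [set [set v | converges_to_infinity v /\ gromov_equivalent u v]
     | u in converges_to_infinity].

End HyperbolicSpaces.

Arguments gromov_boundary {R} X _.

Definition expgz (Gamma : groupType) (g : Gamma) (n : int) : Gamma :=
  match n with
  | Posz k => (g ^+ k)%g
  | Negz k => (g ^- k.+1)%g
  end.

Record isometric_action (Gamma : groupType) (R : realType) (X : metricType R) :=
  IsometricAction {
    act :> Gamma -> X -> X ;
    act1 : forall x, act 1%g x = x ;
    actM : forall g h x, act (g * h)%g x = act g (act h x) ;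
    act_isometry : forall g x y, mdist (act g x) (act g y) = mdist x y }.

Section Actions.
Variables (Gamma : groupType) (R : realType) (X : metricType R).
Variable a : isometric_action Gamma X.

(* Some orbit map n |-> g^n x is a quasi-isometric embedding of the integers;
   by isometry this is then true of every orbit map. *)
Definition loxodromic (g : Gamma) : Prop :=
  exists x : X, exists L C : R, [/\ 1 <= L, 0 <= C &
    forall m n : int,
      `|m - n|%:~R / L - C <= mdist (a (expgz g m) x) (a (expgz g n) x)
        <= L * `|m - n|%:~R + C].

Definition boundary_act (g : Gamma) (xi : set (nat -> X)) : set (nat -> X) :=
  [set a g \o u | u in xi].

Definition boundary_fix (g : Gamma) : set (set (nat -> X)) :=
  [set xi | gromov_boundary X xi /\ boundary_act g xi = xi].

Definition independent (g h : Gamma) : Prop :=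
  boundary_fix g `&` boundary_fix h = set0.

(* Non-elementarity of the restriction of the action to the subgroup H. *)
Definition non_elementary_on (H : set Gamma) : Prop :=
  exists g h : Gamma,
    [/\ H g, H h, loxodromic g, loxodromic h & independent g h].

End Actions.

(* Main.v *)
(** The minimal displacement [inf_y d(y, f y)] is a conjugacy invariant of an
    isometry [f], and in a [delta]-hyperbolic space it is at least
    [d(o, f (f o)) - d(o, f o) - 2 delta] for every base point [o].  Twisted
    conjugate elements [g], [h] yield automorphisms [inner g * phi] and
    [inner h * phi] conjugate under [Inn G], so it is enough to make this lower
    bound arbitrarily large on the coset [Inn G * phi].  For independent
    loxodromic [g], [h] in [Inn G], either [f = g^n phi] or [f = g^n h^n phi]
    works, according to whether [phi^-1] maps the repelling point of [g] or that
    of [h] away from the attracting point of [g]: then the Gromov product of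
    [f o] and [f^-1 o] stays bounded while [d(o, f o)] tends to infinity. *)
Require Import Defs.
From mathcomp Require Import all_boot all_order all_algebra.
From mathcomp Require Import all_classical all_reals.
From mathcomp Require Import topology normedtype.
From mathcomp Require Import lra.

Set Implicit Arguments.
Unset Strict Implicit.
Unset Printing Implicit Defensive.

Import Order.TTheory GRing.Theory Num.Theory.

Local Open Scope classical_set_scope.
Local Open Scope ring_scope.

(** The minimum is split into a disjunction, so that each case is a linear inequality. *)
Definition delta_hyperbolic (R : realType) (X : metricType R) (delta : R) :=
  forall w x y z : X,
  gromov_product w x y - delta <= gromov_product w x z \/
  gromov_product w y z - delta <= gromov_product w x z.

(** * Gromov products and sequences at infinity *)

Section GromovProduct.
Variables (R : realType) (X : metricType R).
Implicit Types (w x y z : X) (u v : nat -> X).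

Lemma gromov_productC w x y : gromov_product w x y = gromov_product w y x.
Proof. by rewrite /gromov_product (metric_sym x y) [mdist w x + _]addrC. Qed.

Lemma gromov_product_base w w' x y :
  gromov_product w x y - mdist w w' <= gromov_product w' x y.
Proof.
rewrite /gromov_product.
have := metric_triangle w w' x; have := metric_triangle w w' y; lra.
Qed.

Lemma gromov_product_move w x y y' :
  gromov_product w x y - mdist y y' <= gromov_product w x y'.
Proof.
rewrite /gromov_product.
have := metric_triangle w y' y; have := metric_triangle x y y'.
rewrite (metric_sym y' y); lra.
Qed.

(** One base point suffices: moving it from [o] to [w] lowers the product by at most [mdist o w]. *)
Lemma gromov_equivalentP o u v :
  gromov_equivalent u v <->
  forall M : R, exists N, forall p q, (N <= p)%N -> (N <= q)%N ->
    M <= gromov_product o (u p) (v q).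
Proof.
split=> [+ M|uv w].
  move=> /(_ o)/cvgryPge/(_ M) [[A B] /= [[N1 _ hA] [N2 _ hB]] AB].
  exists (maxn N1 N2) => p q; rewrite !geq_max => /andP[p1 _] /andP[_ q2].
  by apply: (AB (p, q)); split; [exact: hA|exact: hB].
apply/cvgryPge => M; have [N hN] := uv (M + mdist o w).
exists ([set n | (N <= n)%N], [set n | (N <= n)%N]).
  by split; exact: nbhs_infty_ge.
move=> [p q] [/= Np Nq].
by have := hN _ _ Np Nq; have := gromov_product_base o w (u p) (v q); lra.
Qed.

Lemma gromov_equivalent_sym u v : gromov_equivalent u v -> gromov_equivalent v u.
Proof.
move=> uv; apply/(gromov_equivalentP (u 0)) => M.
have [N hN] := (gromov_equivalentP (u 0) _ _).1 uv M.
by exists N => p q Np Nq; rewrite gromov_productC; exact: hN.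
Qed.

Section Hyperbolic.
Variable delta : R.
Hypothesis hyp : delta_hyperbolic X delta.

Lemma gromov_equivalent_trans v u u' :
  gromov_equivalent u v -> gromov_equivalent v u' -> gromov_equivalent u u'.
Proof.
move=> uv vu'; apply/(gromov_equivalentP (u 0)) => M.
have [N hN] := (gromov_equivalentP (u 0) _ _).1 uv (M + delta).
have [N' hN'] := (gromov_equivalentP (u 0) _ _).1 vu' (M + delta).
exists (maxn N N') => p q; rewrite !geq_max => /andP[Np _] /andP[_ N'q].
have := hN p (maxn N N') Np (leq_maxl _ _).
have := hN' (maxn N N') q (leq_maxr _ _) N'q.
by have [] := hyp (u 0) (u p) (v (maxn N N')) (u' q); lra.
Qed.

Lemma four_point x y z t :
  mdist x z + mdist y t <= mdist x y + mdist z t + 2 * delta \/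
  mdist x z + mdist y t <= mdist x t + mdist y z + 2 * delta.
Proof.
have := hyp x y z t; rewrite /gromov_product.
by case=> ?; [right|left]; lra.
Qed.

End Hyperbolic.
End GromovProduct.

(** * Orbit lengths and displacement *)

Section Displacement.
Variables (Gamma : groupType) (R : realType) (X : metricType R).
Variable a : isometric_action Gamma X.
Implicit Types (f g h x y : Gamma) (o w : X).

Local Open Scope group_scope.

Definition orbit_length o g : R := mdist o (a g o).

Lemma actVK g : cancel (a g^-1) (a g).
Proof. by move=> w; rewrite -actM mulgV act1. Qed.

Lemma gromov_product_act g w u v :
  gromov_product (a g w) (a g u) (a g v) = gromov_product w u v.
Proof. by rewrite /gromov_product !act_isometry. Qed.

Lemma mdist_orbit o x y : mdist (a x o) (a y o) = orbit_length o (x^-1 * y).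
Proof. by rewrite -(act_isometry a x^-1) -!actM mulVg act1. Qed.

Lemma orbit_lengthV o x : orbit_length o x^-1 = orbit_length o x.
Proof. by rewrite -[x in RHS]mulg1 -{2}(invgK x) -mdist_orbit act1 metric_sym. Qed.

Lemma orbit_lengthM o x y :
  (orbit_length o (x * y) <= orbit_length o x + orbit_length o y)%R.
Proof. by rewrite -[in leRHS](mulKg x y) -mdist_orbit; exact: metric_triangle. Qed.

Lemma orbit_length1 o : orbit_length o 1 = 0%R.
Proof. by rewrite /orbit_length act1 mdistxx. Qed.

Lemma mdist_orbit_expg o f m n :
  mdist (a (f ^+ m) o) (a (f ^+ (m + n)) o) = orbit_length o (f ^+ n).
Proof. by rewrite mdist_orbit expgnDr mulKg. Qed.

Lemma gromov_product_orbit o x y :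
  gromov_product o (a x o) (a y o) =
  ((orbit_length o x + orbit_length o y - orbit_length o (x^-1 * y)) / 2)%R.
Proof. by rewrite /gromov_product mdist_orbit. Qed.

Variable delta : R.
Hypothesis hyp : delta_hyperbolic X delta.
Hypothesis delta0 : (0 <= delta)%R.

(** Four-point inequality for o, f o, f (f o), w: both d(f (f o), w) and d(o, w) = d(f o, f w) are
    at most d(f o, w) + d(w, f w), and d(f o, w) cancels. *)
Lemma displacement_ge o f w :
  (orbit_length o (f * f) - orbit_length o f - 2 * delta <= mdist w (a f w))%R.
Proof.
have := four_point hyp o (a f o) (a (f * f) o) w; rewrite /orbit_length.
have := act_isometry a f o w; have := act_isometry a f (a f o) w.
have := act_isometry a f o (a f o); rewrite actM.
have := metric_triangle (a f (a f o)) (a f w) w.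
have := metric_triangle (a f o) w (a f w).
rewrite (metric_sym (a f w) w) (metric_sym o w).
by move=> ? ? ? ? ? []; lra.
Qed.

(** * Orbits escaping at unit speed *)

Definition escaping o f : Prop :=
  forall n, (orbit_length o (f ^+ n) + 1 <= orbit_length o (f ^+ n.+1))%R.

(** In the four-point inequality for the images of [o] under the powers 0, 1, 2 and n + 2 of [f],
    one alternative contradicts the induction hypothesis and the other is the next step. *)
Lemma escaping_of_square o f :
  (orbit_length o f + 2 * delta + 1 <= orbit_length o (f ^+ 2))%R -> escaping o f.
Proof.
move=> f2; elim=> [|n IHn].
  rewrite expg0 expg1 orbit_length1.
  by have := orbit_lengthM o f f; have := delta0; rewrite -expg2; lra.
have := four_point hyp
  (a (f ^+ 0) o) (a (f ^+ 1) o) (a (f ^+ 2) o) (a (f ^+ n.+2) o).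
rewrite (mdist_orbit_expg o f 0 2) (mdist_orbit_expg o f 1 n.+1).
rewrite (mdist_orbit_expg o f 0 1) (mdist_orbit_expg o f 2 n).
rewrite (mdist_orbit_expg o f 0 n.+2) (mdist_orbit_expg o f 1 1) expg1.
by case; lra.
Qed.

Lemma escapingV o f : escaping o f -> escaping o f^-1.
Proof. by move=> ef n; rewrite !expVgn !orbit_lengthV. Qed.

Lemma escaping_addn o f m n : escaping o f ->
  (orbit_length o (f ^+ n) + m%:R <= orbit_length o (f ^+ (m + n)))%R.
Proof.
move=> ef; elim: m => [|m IHm]; first by rewrite addr0.
by rewrite addSn -natr1; have := ef (m + n)%N; lra.
Qed.

Lemma escaping_ge o f n : escaping o f -> (n%:R <= orbit_length o (f ^+ n))%R.
Proof. by move/(@escaping_addn o f n 0); rewrite addn0 expg0 orbit_length1 add0r. Qed.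

Lemma escaping_gromov_product o f (B m n : nat) : escaping o f ->
  (B <= m)%N -> (B <= n)%N ->
  (B%:R <= gromov_product o (a (f ^+ m)%g o) (a (f ^+ n)%g o))%R.
Proof.
move=> ef; wlog mn : m n / (m <= n)%N => [H Bm Bn|Bm _].
  by have /orP[/H|/H] := leq_total m n; [|rewrite gromov_productC]; apply.
(* Escaping bounds the length of f^n below by that of f^(n-m) plus m, and the length of f^m by m. *)
rewrite /gromov_product -(subnKC mn) mdist_orbit_expg.
have := escaping_addn m (n - m) ef; have := escaping_ge m ef; rewrite /orbit_length.
by move: Bm; rewrite -(ler_nat R); lra.
Qed.

Lemma escaping_converges o f : escaping o f ->
  converges_to_infinity (fun n => a (f ^+ n) o).
Proof.
move=> ef; apply/(gromov_equivalentP o) => M.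
have [B MB] : exists B : nat, (M <= B%:R)%R.
  by exists (Num.bound M); exact/ltW/unstable.ltr_bound.
by exists B => p q Bp Bq; apply: le_trans MB _; exact: escaping_gromov_product.
Qed.

(** * Fixed points on the boundary *)

Definition boundary_point (u : nat -> X) : set (nat -> X) :=
  [set v | converges_to_infinity v /\ gromov_equivalent u v].

Lemma gromov_equivalent_act g (u v : nat -> X) :
  gromov_equivalent u v -> gromov_equivalent (a g \o u) (a g \o v).
Proof.
move=> uv w; rewrite -(actVK g w).
under eq_fun => p do rewrite /= gromov_product_act.
exact: uv.
Qed.

Lemma gromov_equivalent_near (D : R) (u u' v : nat -> X) :
  (forall n, mdist (u n) (u' n) <= D)%R ->
  gromov_equivalent u v -> gromov_equivalent u' v.
Proof.
move=> uu' uv; apply/(gromov_equivalentP (u 0%N)) => M.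
have [N hN] := (gromov_equivalentP (u 0%N) _ _).1 uv (M + D)%R.
exists N => p q Np Nq; have := hN _ _ Np Nq; have := uu' p.
rewrite gromov_productC (gromov_productC _ (u' p)).
by have := gromov_product_move (u 0%N) (v q) (u p) (u' p); lra.
Qed.

Lemma boundary_point_act_sub g (D : R) (u : nat -> X) :
  (forall n, mdist (a g (u n)) (u n) <= D)%R ->
  boundary_act a g (boundary_point u) `<=` boundary_point u.
Proof.
move=> gu _ [v [vv uv] <-]; split; first exact: gromov_equivalent_act.
exact: gromov_equivalent_near gu (gromov_equivalent_act _ uv).
Qed.

Lemma boundary_fix_point g (D : R) (u : nat -> X) :
  converges_to_infinity u -> (forall n, mdist (a g (u n)) (u n) <= D)%R ->
  boundary_fix a g (boundary_point u).
Proof.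
move=> uu gu; split; first by exists u.
apply/seteqP; split; first exact: boundary_point_act_sub gu.
(* The reverse inclusion is the first one for [g^-1], which moves the points of [u] equally far. *)
move=> v uv; exists (a g^-1 \o v).
  apply: (@boundary_point_act_sub g^-1 D); last by exists v.
  by move=> n; rewrite -(act_isometry a g) actVK metric_sym.
by apply/funext => n /=; rewrite actVK.
Qed.

Lemma boundary_fix_escaping o g f : commute g f -> escaping o f ->
  boundary_fix a g (boundary_point (fun n => a (f ^+ n) o)).
Proof.
move=> gf ef; apply: (@boundary_fix_point _ (orbit_length o g)).
  exact: escaping_converges.
move=> n; rewrite -actM (commuteX n gf) actM act_isometry metric_sym.
exact: lexx.
Qed.

(** Otherwise the two orbits would have a common limit, fixed by both [g] and [h]. Commutation
    allows [f] and [f'] to be powers of either sign, hence treats attracting and repelling points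
    alike. *)
Lemma independent_gromov_product_bounded o g h f f' :
  independent a g h -> commute g f -> commute h f' ->
  escaping o f -> escaping o f' ->
  exists B : nat, forall n, (B <= n)%N ->
    (gromov_product o (a (f ^+ n)%g o) (a (f' ^+ n)%g o) <= B%:R)%R.
Proof.
move=> gh gf hf' ef ef'; apply: contrapT => unbounded.
have eqv : gromov_equivalent (fun n => a (f ^+ n) o) (fun n => a (f' ^+ n) o).
  apply/(gromov_equivalentP o) => M; pose B := Num.bound (M + 2 * delta)%R.
  have MB : (M + 2 * delta <= B%:R)%R by exact/ltW/unstable.ltr_bound.
  have [n Bn Bff'] : exists2 n, (B <= n)%N &
      (B%:R < gromov_product o (a (f ^+ n)%g o) (a (f' ^+ n)%g o))%R.
    apply: contrapT => H; apply: unbounded; exists B => n Bn.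
    by rewrite leNgt; apply/negP => ?; apply: H; exists n.
  (* Going from f^p through f^n and f'^n to f'^q uses hyperbolicity twice, whence the 2 delta in
     [B]. *)
  exists B => p q Bp Bq.
  have := escaping_gromov_product ef Bp Bn.
  have := escaping_gromov_product ef' Bn Bq.
  have := delta0.
  case: (hyp o (a (f ^+ p)%g o) (a (f ^+ n)%g o) (a (f' ^+ q)%g o)) => ?;
  case: (hyp o (a (f ^+ n)%g o) (a (f' ^+ n)%g o) (a (f' ^+ q)%g o)) => ?; lra.
have pE : boundary_point (fun n => a (f ^+ n) o) =
          boundary_point (fun n => a (f' ^+ n) o).
  apply/seteqP; split => v [vv uv]; split => //.
    exact: (gromov_equivalent_trans hyp (gromov_equivalent_sym eqv)).
  exact: (gromov_equivalent_trans hyp eqv).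
suff : (boundary_fix a g `&` boundary_fix a h) (boundary_point (fun n => a (f ^+ n) o)).
  by rewrite [_ `&` _]gh.
by split; [|rewrite pE]; exact: boundary_fix_escaping.
Qed.

(** * Loxodromic elements: growth of powers and large displacement *)

Lemma loxodromic_expg o g (K : R) : loxodromic a g ->
  exists N, (orbit_length o (g ^+ N) + K <= orbit_length o ((g ^+ N) ^+ 2))%R.
Proof.
(* If every [N] failed, each doubling of the exponent would add less than [K]: the length of g^(2^j)
   would be at most linear in j, against a lower bound linear in 2^j. *)
move=> [x [L [C [L1 C0 qi]]]]; apply: contrapT => noN.
have growth n : (n%:R / L - C - 2 * mdist o x <= orbit_length o (g ^+ n))%R.
  have /andP[+ _] := qi 0 (Posz n); rewrite /= act1 sub0r normrN.
  have := metric_triangle x o (a (g ^+ n) x).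
  have := metric_triangle o (a (g ^+ n) o) (a (g ^+ n) x).
  rewrite act_isometry (metric_sym x o) /orbit_length; lra.
have doubling j : (orbit_length o (g ^+ (2 ^ j)) <= orbit_length o g + j%:R * K)%R.
  elim: j => [|j IHj]; first by rewrite expg1; lra.
  rewrite expnSr expgnA -natr1 leNgt; apply/negP => lt_j.
  by apply: noN; exists (2 ^ j)%N; lra.
pose A := (orbit_length o g + C + 2 * mdist o x)%R.
(* Weakening 2^(2i) to i^2 leaves a quadratic term against a linear one, which [nra] can handle. *)
have bound i : (i%:R * i%:R <= L * (A + i%:R * (2 * `|K|)))%R.
  have L0 : (0 < L)%R by lra.
  rewrite -ler_pdivrMl// mulrC.
  have := growth (2 ^ (i + i))%N; have := doubling (i + i)%N.
  have : (i%:R * i%:R / L <= (2 ^ (i + i))%:R / L :> R)%R.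
    rewrite ler_pM2r ?invr_gt0// -natrM ler_nat expnD.
    by rewrite leq_mul// ltnW// ltn_expl.
  have : ((i + i)%:R * K <= i%:R * (2 * `|K|))%R.
    by rewrite natrD; have := ler_norm K; have := ler0n R i; nra.
  rewrite /A; lra.
have A0 : (0 <= A)%R.
  by rewrite /A addr_ge0 ?addr_ge0 ?mulr_ge0 ?mdist_ge0.
pose i := (Num.bound (L * (A + 2 * `|K|))%R).+1.
have := bound i.
have : (L * (A + 2 * `|K|) < i%:R)%R.
  by apply: (lt_le_trans (unstable.ltr_bound _)); rewrite ler_nat.
have i1 : (1 <= i%:R :> R)%R by rewrite ler1n.
have LA : (0 <= L * A)%R by rewrite mulr_ge0//; lra.
nra.
Qed.

(** The gain from f to f f in orbit length is the length of f minus twice the product of f o and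
    f^-1 o, so f must be long with this product bounded. *)
Lemma displacement_unbounded o g h phi (B : nat) :
  escaping o g -> escaping o h ->
  (forall n, (B <= n)%N ->
    (gromov_product o (a (g^-1 ^+ n)%g o) (a (h^-1 ^+ n)%g o) <= B%:R)%R) ->
  (forall n, (B <= n)%N ->
    (gromov_product o (a (g^-1 ^+ n)%g o) (a (h ^+ n)%g o) <= B%:R)%R) ->
  forall M : R, exists k, (exists n m, k = g ^+ n * h ^+ m) /\
    (M <= orbit_length o (k * phi * (k * phi)) - orbit_length o (k * phi))%R.
Proof.
move=> eg eh gVhV gVh M.
pose D := orbit_length o phi; pose b : R := B%:R%R.
(* The factor 10 is generous slack for the multiples of [b], [D] and [delta] lost below. *)
pose n := maxn B (Num.bound (`|M| + 1 + 10 * (b + D + delta)))%R.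
have D0 : (0 <= D)%R by exact: mdist_ge0.
have b0 : (0 <= b)%R by exact: ler0n.
have M0 := ler_norm M; have M1 := normr_ge0 M.
have Bn : (B <= n)%N by exact: leq_maxl.
have Mn : (`|M| + 1 + 10 * (b + D + delta) <= n%:R)%R.
  by apply: (le_trans (ltW (unstable.ltr_bound _))); rewrite ler_nat leq_maxr.
have gn := escaping_ge n eg; have hn := escaping_ge n eh.
have := gVhV n Bn; have := gVh n Bn; rewrite -/b !expVgn.
set p := g ^+ n in gn *; set q := h ^+ n in hn *.
rewrite !gromov_product_orbit !orbit_lengthV !invgK => pq pqV.
have lenM x y := orbit_lengthM o x y.
have lenVM x y : orbit_length o (x^-1 * y^-1) = orbit_length o (y * x).
  by rewrite -invgM orbit_lengthV.
have pphi := lenM p phi; have qphi := lenM q phi.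
rewrite -/D in pphi qphi.
pose P x y := gromov_product o (a x o) (a y o).
have PE x y : P x y =
    ((orbit_length o x + orbit_length o y - orbit_length o (x^-1 * y)) / 2)%R.
  exact: gromov_product_orbit.
have E : (P (phi^-1 * p^-1)%g (phi^-1 * q^-1)%g <= b + D)%R.
  rewrite PE invgM !invgK mulgA mulgK !lenVM; lra.
(* By [E], p o cannot be close to both other points. If it is far from the first, f = p phi works,
   as f^-1 = phi^-1 p^-1. *)
have [caseA|caseB] := hyp o (a (phi^-1 * p^-1) o) (a p o) (a (phi^-1 * q^-1) o).
  exists p; split; first by exists n, 0%N; rewrite expg0 mulg1.
  move: caseA E; rewrite -!/(P _ _) [P _ p]PE invgM !invgK lenVM.
  have := lenM (p * phi * (p * phi)) phi^-1; rewrite orbit_lengthV !mulgA mulgK -/D.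
  have := delta0; lra.
(* Here p o is far from phi^-1 q^-1 o, while f o is close to the former and f^-1 o to the latter. *)
pose f := p * q * phi.
exists (p * q); split; first by exists n, n.
have lenMphi x : (orbit_length o x - D <= orbit_length o (x * phi))%R.
  by have := lenM (x * phi) phi^-1; rewrite orbit_lengthV mulgK -/D; lra.
have flen : (orbit_length o (p * q) - D <= orbit_length o f)%R.
  exact: lenMphi.
have Pp : (n%:R - b - D <= P p f)%R.
  rewrite PE (_ : p^-1 * f = q * phi); [lra|by rewrite /f -mulgA mulKg].
have PV : (n%:R - b - D <= P f^-1%g (phi^-1 * q^-1)%g)%R.
  rewrite PE (_ : (f^-1)^-1 * (phi^-1 * q^-1) = p); last by rewrite invgK mulgA !mulgK.
  by have := lenMphi q; rewrite orbit_lengthV lenVM; lra.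
have Pf : P f f^-1%g = (orbit_length o f - orbit_length o (f * f) / 2)%R.
  by rewrite PE lenVM orbit_lengthV; lra.
have := hyp o (a p o) (a f o) (a (phi^-1 * q^-1) o).
have := hyp o (a f o) (a f^-1 o) (a (phi^-1 * q^-1) o).
move: caseB E; rewrite -!/(P _ _) -/f.
by have := delta0; move=> ? ? ? [] ? [] ?; lra.
Qed.

End Displacement.

(** * Inner automorphisms and twisted conjugacy *)

Section InnerAutomorphisms.
Variable G : groupType.
Local Open Scope group_scope.

Lemma innerM (x y : G) : inner (x * y) = inner x * inner y.
Proof. by apply: aut_eqP => z /=; rewrite invgM !mulgA. Qed.

Lemma inner1 : inner (1 : G) = 1.
Proof. by apply: aut_eqP => z /=; rewrite invg1 mulg1 mul1g. Qed.

Lemma innerX (x : G) n : inner (x ^+ n) = inner x ^+ n.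
Proof.
by elim: n => [|n IHn]; rewrite ?expg0 ?inner1// !expgS innerM IHn.
Qed.

Lemma aut1 (phi : Aut G) : phi 1 = 1.
Proof. by apply: (mulgI (phi 1)); rewrite -autM !mulg1. Qed.

(** Twisted conjugation by [x] becomes conjugation by [inner x], stated without an inverse in
    [Aut G] so that it can be checked pointwise. *)
Lemma inner_twisted (phi : Aut G) (x g : G) :
  inner (x * g * (phi x)^-1) * phi * inner x = inner x * (inner g * phi).
Proof.
apply: aut_eqP => z /=; rewrite !autM !invgM invgK !mulgA mulgVK.
by rewrite -(mulgA (x * g * phi z)) -autM mulVg aut1 mulg1.
Qed.

End InnerAutomorphisms.

(** * Finitely many twisted classes against unbounded displacement *)

Theorem proposition2 (G : groupType) (R : realType) (X : metricType R)
    (hgeo : geodesic_space X) (hhyp : gromov_hyperbolic X)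
    (a : isometric_action (Aut G) X)
    (hInn : non_elementary_on a (@Inn G)) :
  R_infinity G.
Proof.
have [delta [delta0 hyp0]] := hhyp.
have hyp : delta_hyperbolic X delta.
  by move=> w x y z; have := hyp0 w x y z; rewrite lerBlDr ge_min -!lerBlDr => /orP.
have [_ [_ [[x _ <-] [y _ <-] lx ly indep]]] := hInn.
have [o _] := lx.
(* The excess 2 delta + 1 is what [escaping_of_square] demands. *)
have [N xN] := loxodromic_expg o (2 * delta + 1) lx.
have [N' yN'] := loxodromic_expg o (2 * delta + 1) ly.
pose g := (inner x ^+ N)%g; pose h := (inner y ^+ N')%g.
have eg : escaping a o g by apply: (escaping_of_square hyp delta0); rewrite -addrA.
have eh : escaping a o h by apply: (escaping_of_square hyp delta0); rewrite -addrA.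
have xg : commute (inner x) g^-1%g by apply/commuteV/commuteX.
have yh : commute (inner y) h by apply/commuteX.
have [B1 gVhV] := independent_gromov_product_bounded hyp delta0 indep xg
  (commuteV yh) (escapingV eg) (escapingV eh).
have [B2 gVh] := independent_gromov_product_bounded hyp delta0 indep xg yh
  (escapingV eg) eh.
have B1R : B1%:R <= (maxn B1 B2)%:R :> R by rewrite ler_nat leq_maxl.
have B2R : B2%:R <= (maxn B1 B2)%:R :> R by rewrite ler_nat leq_maxr.
move=> phi fin.
(* [M] bounds the displacements at [o] of one representative per class. *)
have [M classes_le] : exists M : R, forall z : G, exists w : X,
    mdist w (a (inner z * phi)%g w) <= M.
  pose F (C : set G) := orbit_length a o (inner (xget 1%g C) * phi)%g.
  have /finite_seqP[s sE] := fin.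
  have [M FM] : exists M : R, forall C, C \in s -> F C <= M.
    elim: s {sE} => [|C s [M FM]]; first by exists 0.
    exists (Num.max (F C) M) => C'; rewrite inE le_max => /orP[/eqP->|/FM->].
      by rewrite lexx.
    by rewrite orbT.
  exists M => z; pose C := [set r | twisted_conjugate phi z r].
  have sC : C \in s.
    have : reidemeister_classes phi C by exists z.
    by rewrite sE.
  (* The class is inhabited, so [xget] does not return its default. *)
  have [x' rE] : twisted_conjugate phi z (xget 1%g C).
    by apply: (@xgetPex _ 1%g C); exists (1 * z * (phi 1)^-1)%g, 1%g.
  (* Conjugation by [inner x'] turns the displacement at this point into that of the representative
     at [o]. *)
  exists (a (inner x')^-1%g o); apply: le_trans (FM C sC).
  rewrite -(act_isometry a (inner x')) -!actM -inner_twisted -rE mulgK mulgV.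
  by rewrite act1.
have gVhV' n : (maxn B1 B2 <= n)%N ->
    gromov_product o (a (g^-1 ^+ n)%g o) (a (h^-1 ^+ n)%g o) <= (maxn B1 B2)%:R.
  by rewrite geq_max => /andP[/gVhV/le_trans + _]; apply.
have gVh' n : (maxn B1 B2 <= n)%N ->
    gromov_product o (a (g^-1 ^+ n)%g o) (a (h ^+ n)%g o) <= (maxn B1 B2)%:R.
  by rewrite geq_max => /andP[_ /gVh/le_trans]; apply.
(* [displacement_ge] loses 2 delta; the extra 1 makes the contradiction strict. *)
have [_ [[n [m ->]] large]] :=
  displacement_unbounded hyp delta0 phi eg eh gVhV' gVh' (M + 2 * delta + 1).
have [w] := classes_le ((x ^+ N) ^+ n * (y ^+ N') ^+ m)%g.
rewrite innerM !innerX -/g -/h.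
by have := displacement_ge a hyp o (g ^+ n * h ^+ m * phi)%g w; lra.
Qed.
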